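(* Let $s$, $t$, $m$ and $n$ be integers with $2 \leq s \leq m$ and $2 \leq t \leq n$. For any integer $k$ such that $\max\{2,s^2-2s\} \leq k \leq m$, we have $z(m,n;s,t) \leq B_k(m,n;s,t)$, where \[ B_k(m,n;s,t) = \frac{\binom{m}{s-1}}{\binom{k}{s-1}} \left(\frac{(t-1)(m-s+1)}{s}\left(\frac{\beta(k+1)}{k-s+1}+1\right) - \frac{\alpha \beta(k-s+2)}{k-s+1}\right) + \frac{(k+1)(s-1-\beta)}{s}\,n, \] $\alpha$ is the integer such that $\alpha \equiv (t-1)(m-s+1) \pmod{k-s+1}$ and $0 \leq \alpha < k-s+1$, and \[ \beta = \frac{(s-1)(k-s+1)-\alpha(s-1)}{(k+1)(k-s+1)-\alpha(s-1)}. \]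
   Context: For positive integers $s,t,m,n$, the Zarankiewicz number $z(m,n;s,t)$ is the maximum number of edges in a bipartite graph with parts of sizes $m$ and $n$ (i.e. a subgraph of $K_{m,n}$) that has no complete bipartite subgraph containing $s$ vertices in the part of size $m$ and $t$ vertices in the part of size $n$. Equivalently, it is the maximum total degree (sum of edge sizes) of a hypergraph with $m$ vertices and $n$ edges (edges forming a multiset of subsets of the vertex set) in which each set of $s$ vertices is a subset of at most $t-1$ edges. *)

(* Defs.v *)
From mathcomp Require Import all_boot all_order all_algebra.
Set Implicit Arguments.
Unset Strict Implicit.
Unset Printing Implicit Defensive.
Import Order.TTheory GRing.Theory Num.Theory.

(* A subgraph of K_{m,n} is given by its edge set E : {set 'I_m * 'I_n}. *)
Definition Kst_free (m n s t : nat) (E : {set 'I_m * 'I_n}) : bool :=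
  [forall S : {set 'I_m}, forall T : {set 'I_n},
     (#|S| == s) && (#|T| == t) ==> ~~ (setX S T \subset E)].

(* For positive s and t the empty graph is Kst_free, so the maximum is
   attained. *)
Definition zarankiewicz (m n s t : nat) : nat :=
  \max_(E : {set 'I_m * 'I_n} | Kst_free s t E) #|E|.

(* Subtraction is on nat; it never truncates when 1 <= t, s <= m and s <= k.
   The last inequality follows from max {2, s^2 - 2s} <= k when 2 <= s. *)
Definition alpha (m s t k : nat) : nat :=
  ((t - 1) * (m - s + 1)) %% (k - s + 1).

Local Open Scope ring_scope.

Definition beta (m s t k : nat) : rat :=
  let a : rat := (alpha m s t k)%:R in
  ((s%:R - 1) * (k%:R - s%:R + 1) - a * (s%:R - 1)) /
  ((k%:R + 1) * (k%:R - s%:R + 1) - a * (s%:R - 1)).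

Definition Bk (k m n s t : nat) : rat :=
  let a : rat := (alpha m s t k)%:R in
  let b := beta m s t k in
  'C(m, (s - 1)%N)%:R / 'C(k, (s - 1)%N)%:R *
    ((t%:R - 1) * (m%:R - s%:R + 1) / s%:R *
       (b * (k%:R + 1) / (k%:R - s%:R + 1) + 1)
     - a * b * (k%:R - s%:R + 2) / (k%:R - s%:R + 1))
  + (k%:R + 1) * (s%:R - 1 - b) / s%:R * n%:R.

(* Main.v *)
(* Write d = k - s + 1 and N = (t - 1)(m - s + 1) = q d + alpha.  For an
   (s-1)-set S of vertices, the excesses |e| - s + 1 of the edges e containing S
   sum to at most N.  Let f be the concave piecewise linear function of the
   excess with value h at d, slope y below d and slope om above d; the
   hypothesis s^2 - 2s <= k makes om nonnegative.  Using the slope-om line when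
   at most q edges contain S, and the slope-y line when at least q + 1 do, one
   gets that f sums to at most q h + alpha om over the edges containing S; beta
   is exactly the value for which the two cases give the same bound.
   On the other hand |e| <= 'C(|e|, s-1) f / 'C(k, s-1) + c for every edge, with
   equality at |e| = k-1, k, k+1: this inequality is affine in the parameters,
   and at the extreme parameters it reduces to monotonicity and convexity of
   binomial coefficients.  Double counting the pairs (S, e) concludes. *)
Require Import Defs.
From mathcomp Require Import all_boot all_order all_algebra.
From mathcomp Require Import ring lra zify.
Import Order.TTheory GRing.Theory Num.Theory.
Local Open Scope ring_scope.

(** * Binomial inequalities and the bound for a single edge *)

(** Convexity: the increment of ['C(_, r.+1)] at x is ['C(x, r)], nondecreasing in x. The first
    increment is used here, the last one in the next lemma. *)
Lemma bin_tangent_ge (k i r : nat) :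
  ('C(k, r.+1) + i * 'C(k, r) <= 'C(k + i, r.+1))%N.
Proof.
elim: i => [|i IHi]; first by rewrite addn0 mul0n addn0.
have h : ('C(k, r) <= 'C(k + i, r))%N by apply: leq_bin2l; rewrite leq_addr.
by rewrite addnS binS mulSn; lia.
Qed.

Lemma bin_tangent_le (k i r : nat) :
  ('C(k + i, r.+1) <= 'C(k, r.+1) + i * 'C((k + i).-1, r))%N.
Proof.
elim: i => [|i IHi]; first by rewrite addn0 mul0n addn0.
have h : ('C((k + i).-1, r) <= 'C(k + i, r))%N by apply: leq_bin2l; lia.
by rewrite addnS binS /= mulSn; nia.
Qed.

Lemma mul_bin_subR (j r : nat) :
  (j%:R - r%:R) * ('C(j, r))%:R = r.+1%:R * ('C(j, r.+1))%:R :> rat.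
Proof.
have [rj|jr] := leqP r j; last by rewrite !bin_small ?mulr0 //; lia.
by rewrite -natrB // -!natrM mul_bin_left.
Qed.

(** Treats edges of size [j] at most k = d + r. The relation between [y] and [h] amounts to equality
    at j = k - 1. *)
Lemma lower_line (r d j : nat) (h y : rat) :
  (0 < d)%N -> (j <= d + r)%N -> 0 <= h -> r.+1%:R * h <= (d + r)%:R ->
  d%:R * y = (d + r)%:R - r%:R * h ->
  h + j%:R - (d + r)%:R
    <= 'C(j, r)%:R / 'C(d + r, r)%:R * (h + y * (j%:R - (d + r)%:R)).
Proof.
move=> d0 jk h0 hk yE.
have dR : 0 < d%:R :> rat by rewrite ltr0n.
have CK : 0 < 'C(d + r, r)%:R :> rat by rewrite ltr0n bin_gt0 leq_addl.
rewrite mulrAC ler_pdivlMr //.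
have [i kE] : exists i, (d + r = j + i)%N by exists (d + r - j)%N; lia.
(* the inequality is affine in h: check it at h = 0 and at h = k / s *)
have e0 : i%:R * (d + r)%:R * 'C(j, r)%:R <= i%:R * d%:R * 'C(d + r, r)%:R :> rat.
  rewrite -!natrM ler_nat.
  case: i kE => [|i] kE; first by rewrite !mul0n.
  rewrite -!mulnA leq_mul2l /=.
  (* Since k C(k-1, r) = d C(k, r), what remains is C(j, r) <= C(k-1, r), true because j < k. *)
  have := mul_bin_down (d + r) r; rewrite addnK => <-.
  by rewrite leq_mul2l leq_bin2l ?orbT //; lia.
have e1 : ((d + r)%:R - i%:R * r.+1%:R) * d%:R * 'C(d + r, r)%:R
    <= (d + r)%:R * (d%:R - i%:R) * 'C(j, r)%:R :> rat.
  (* For h = k / s: the tangent bound from j to k, multiplied by k (r + 1) and rewritten with C(j,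
     r) and C(k, r) only. *)
  have t := bin_tangent_le j i r; rewrite -kE in t.
  have b1 := mul_bin_subR (d + r) r; have b2 := mul_bin_subR j r.
  have diag := mul_bin_diag (d + r) r.
  have jE : j%:R = d%:R + r%:R - i%:R :> rat by rewrite -natrD kE natrD addrK.
  move: t diag; rewrite -(ler_nat rat) natrD natrM => t.
  move/(congr1 (fun x : nat => x%:R : rat)); rewrite !natrM => diag.
  rewrite natrD addrK in b1; rewrite jE in b2.
  have t' := ler_wpM2l (ler0n rat ((d + r) * r.+1)) t.
  rewrite natrM in t'; rewrite !natrD in t' diag *.
  set C := 'C(d + r, r)%:R in b1 *; set C1 := 'C(d + r, r.+1)%:R in b1 diag t'.
  set D := 'C((d + r).-1, r)%:R in diag t'; set B := 'C(j, r)%:R in b2 *.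
  set B1 := 'C(j, r.+1)%:R in b2 t'.
  rewrite -subr_ge0 in t'; rewrite -subr_ge0.
  have -> // : (d%:R + r%:R) * (d%:R - i%:R) * B
     - (d%:R + r%:R - i%:R * r.+1%:R) * d%:R * C
     = (d%:R + r%:R) * r.+1%:R * (B1 + i%:R * D)
       - (d%:R + r%:R) * r.+1%:R * C1.
  have b2' : (d%:R - i%:R) * B = r.+1%:R * B1 by rewrite -b2; ring.
  have -> : (d%:R + r%:R) * r.+1%:R * (B1 + i%:R * D)
     = (d%:R + r%:R) * (r.+1%:R * B1) + i%:R * r.+1%:R * ((d%:R + r%:R) * D) by ring.
  rewrite diag -b2'.
  have -> : i%:R * r.+1%:R * (r.+1%:R * C1) = i%:R * r.+1%:R * (d%:R * C) by rewrite b1.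
  have -> : (d%:R + r%:R) * r.+1%:R * C1 = (d%:R + r%:R) * (d%:R * C) by rewrite b1; ring.
  ring.
have jE : j%:R = (d + r)%:R - i%:R :> rat by rewrite kE natrD addrK.
have k0 : 0 < (d + r)%:R :> rat by rewrite ltr0n; lia.
rewrite -(ler_pM2l (mulr_gt0 k0 dR)) -subr_ge0.
rewrite jE; set K := (d + r)%:R in hk yE e0 e1 jE k0 *.
set C := 'C(d + r, r)%:R in e0 e1 *; set B := 'C(j, r)%:R in e0 e1 *.
(* Interpolation: the two extreme cases get the nonnegative weights [K - r.+1%:R * h] and [h]. *)
have -> : K * d%:R * (B * (h + y * (K - i%:R - K)))
   - K * d%:R * ((h + (K - i%:R) - K) * C) =
   (K - r.+1%:R * h) * (i%:R * d%:R * C - i%:R * K * B)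
   + h * (K * (d%:R - i%:R) * B - (K - i%:R * r.+1%:R) * d%:R * C)
   by rewrite -(natr1 r); ring: yE (natrD rat d r).
by apply: addr_ge0; apply: mulr_ge0 => //; rewrite subr_ge0.
Qed.

(** Treats edges of size k + i with k = d + r. The slope is the one giving equality at i = 1. *)
Lemma upper_line (r d i : nat) (b : rat) :
  (0 < d)%N -> (0 < r)%N -> 0 <= b -> r%:R * b <= 1 ->
  let h := (d%:R + (d%:R + r%:R + 1) * b) / r.+1%:R in
  h + i%:R <=
    'C(d + r + i, r)%:R / 'C(d + r, r)%:R * (h + (1 - r%:R * b) / r.+1%:R * i%:R).
Proof.
move=> d0 r0 b0 b1 /=.
have CK : 0 < 'C(d + r, r)%:R :> rat by rewrite ltr0n bin_gt0 leq_addl.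
have sR : 0 < r.+1%:R :> rat by rewrite ltr0n.
rewrite mulrAC ler_pdivlMr //.
(* the inequality is affine in b: check it at b = 0 and at b = 1 / r *)
have e0 : (d%:R + r.+1%:R * i%:R) * 'C(d + r, r)%:R
    <= (d%:R + i%:R) * 'C(d + r + i, r)%:R :> rat.
  have := bin_tangent_ge (d + r) i r.
  rewrite -(ler_nat rat) natrD natrM => t.
  have := ler_wpM2l (ltW sR) t.
  rewrite mulrDr -!mul_bin_subR !natrD.
  by rewrite addrK -(addrA d%:R) (addrC r%:R) addrA addrK; lra.
have e1 : (d%:R + 1 + r%:R * i%:R) * 'C(d + r, r)%:R
    <= (d%:R + 1) * 'C(d + r + i, r)%:R :> rat.
  (* At b = 1 / r the slope vanishes and convexity is needed for ['C(_, r)] itself, hence the shift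
     of [r]. *)
  case: r r0 {b1 CK sR e0} => // r _.
  have := bin_tangent_ge (d + r.+1) i r.
  rewrite -(ler_nat rat) natrD natrM => t.
  have dR : 0 <= d%:R + 1 :> rat by rewrite natr1 ler0n.
  have := ler_wpM2l dR t.
  have kr : (d + r.+1)%:R - r%:R = d%:R + 1 :> rat.
    by rewrite natrD -(natr1 r); ring.
  have := mul_bin_subR (d + r.+1) r; rewrite kr mulrDr mulrCA => ->.
  by rewrite mulrA -mulrDl [_ * r.+1%:R]mulrC.
set C := 'C(d + r, r)%:R in CK e0 e1 *; set B := 'C(d + r + i, r)%:R in e0 e1 *.
rewrite -(ler_pM2l sR) -subr_ge0.
have s0 : 1 + r%:R != 0 :> rat by rewrite addrC natr1 pnatr_eq0.
have -> : r.+1%:R * (B * ((d%:R + (d%:R + r%:R + 1) * b) / r.+1%:R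
      + (1 - r%:R * b) / r.+1%:R * i%:R))
   - r.+1%:R * (((d%:R + (d%:R + r%:R + 1) * b) / r.+1%:R + i%:R) * C)
   = (1 - r%:R * b) * ((d%:R + i%:R) * B - (d%:R + r.+1%:R * i%:R) * C)
   + r.+1%:R * b * ((d%:R + 1) * B - (d%:R + 1 + r%:R * i%:R) * C).
  by rewrite -(natr1 r); field; rewrite addrC.
apply: addr_ge0; apply: mulr_ge0; rewrite ?subr_ge0 //.
by apply: mulr_ge0 => //; apply: ltW.
Qed.

(** * Sums of a concave function under a bounded total weight *)

(** A line of slope z sums to |P| (h - z d) + z N, nondecreasing in |P| for z = [om] and
    nonincreasing for z = [y]. The last hypothesis makes the value for [om] at |P| = q equal that
    for [y] at q + 1. *)
Lemma sum_concave_le {I : finType} {P : pred I} (w : I -> nat) {f : I -> rat}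
    {N q a : nat} (d : nat) {h : rat} (y : rat) {om : rat} :
  N = (q * d + a)%N -> (\sum_(i | P i) w i <= N)%N ->
  (forall i, P i -> f i <= h + om * ((w i)%:R - d%:R)) ->
  (forall i, P i -> f i <= h + y * ((w i)%:R - d%:R)) ->
  0 <= om -> 0 <= y -> om * d%:R <= h -> h <= y * d%:R ->
  y * (d%:R - a%:R) = h - a%:R * om ->
  \sum_(i | P i) f i <= q%:R * h + a%:R * om.
Proof.
move=> NE wN fom fy om0 y0 omh hy yE.
have line z : 0 <= z -> (forall i, P i -> f i <= h + z * ((w i)%:R - d%:R)) ->
    \sum_(i | P i) f i <= #|P|%:R * (h - z * d%:R) + z * N%:R.
  move=> z0 fz; apply: le_trans (ler_sum _ fz) _.
  have -> : \sum_(i | P i) (h + z * ((w i)%:R - d%:R))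
      = #|P|%:R * (h - z * d%:R) + z * (\sum_(i | P i) w i)%:R.
    rewrite natr_sum mulr_sumr mulr_natl -sumr_const -big_split /=.
    by apply: eq_bigr => i _; ring.
  by rewrite lerD2l ler_wpM2l // ler_nat.
have NR : N%:R = q%:R * d%:R + a%:R :> rat by rewrite NE natrD natrM.
have [xq|qx] := leqP #|P| q.
  apply: le_trans (line om om0 fom) _; rewrite NR.
  have : #|P|%:R * (h - om * d%:R) <= q%:R * (h - om * d%:R).
    by rewrite ler_wpM2r ?subr_ge0 // ler_nat.
  lra.
apply: le_trans (line y y0 fy) _; rewrite NR.
have : #|P|%:R * (h - y * d%:R) <= q.+1%:R * (h - y * d%:R).
  by rewrite ler_wnM2r ?subr_le0 // ler_nat.
by rewrite -(natr1 q); lra.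
Qed.

(** * Double counting of incidences *)

Section Incidence.

Context {m n : nat} (E : {set 'I_m * 'I_n}).

Definition edge_set (i : 'I_n) : {set 'I_m} := [set v | (v, i) \in E].

Lemma card_incidence : #|E| = (\sum_i #|edge_set i|)%N.
Proof.
rewrite -sum1_card big_mkcond /=.
under [RHS]eq_bigr => i _ do rewrite -sum1_card big_mkcond /=.
rewrite exchange_big pair_big /=.
by apply: eq_bigr => -[v i] _; rewrite inE.
Qed.

(** Otherwise [t] of the edges containing [S] would form a forbidden complete subgraph with it. *)
Lemma Kst_free_degree {s t : nat} {S : {set 'I_m}} :
  Kst_free s t E -> #|S| = s -> (#|[set i | S \subset edge_set i]| < t)%N.
Proof.
move=> /forallP/(_ S)/forallP free Ss; rewrite ltnNge; apply/negP => tT.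
have : (0 < #|[set T : {set 'I_n} |
    T \subset [set i | S \subset edge_set i] & #|T| == t]|)%N.
  by rewrite cards_draws bin_gt0.
case/card_gt0P => T; rewrite inE => /andP[TS Tt].
move: (free T); rewrite Ss eqxx Tt /= => /negP; apply.
apply/subsetP => -[v i]; rewrite inE /= => /andP[vS iT].
move/subsetP/(_ i iT): TS; rewrite inE => /subsetP/(_ v vS).
by rewrite inE.
Qed.

(** The excess counts the vertices of an edge outside [S]. Each of the m - r vertices outside [S]
    extends it to an (r+1)-set, which lies in at most t - 1 edges. *)
Lemma Kst_free_excess (r t : nat) (S : {set 'I_m}) :
  Kst_free r.+1 t E -> #|S| = r ->
  (\sum_(i | S \subset edge_set i) (#|edge_set i| - r) <= (t - 1) * (m - r))%N.
Proof.
move=> free Sr.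
have -> : (\sum_(i | S \subset edge_set i) (#|edge_set i| - r)
    = \sum_(i | S \subset edge_set i) \sum_(v in ~: S) (v \in edge_set i))%N.
  apply: eq_bigr => i Si.
  rewrite -Sr -cardsDS // -sum1_card big_mkcond /= [RHS]big_mkcond /=.
  by apply: eq_bigr => v _; rewrite !inE; case: (v \in S) => //=; case: (_ \in E).
rewrite exchange_big /=.
have -> : ((t - 1) * (m - r) = \sum_(v in ~: S) (t - 1))%N.
  by rewrite sum_nat_const cardsCs setCK card_ord Sr mulnC.
apply: leq_sum => v; rewrite inE => vS.
have vr : #|v |: S| = r.+1 by rewrite cardsU1 vS Sr.
have lt := Kst_free_degree free vr.
have -> : (\sum_(i | S \subset edge_set i) (v \in edge_set i)
   = #|[set i | v |: S \subset edge_set i]|)%N.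
  rewrite -sum1_card big_mkcond /= [RHS]big_mkcond /=.
  apply: eq_bigr => i _; rewrite !inE subUset sub1set inE.
  by case: (S \subset _); case: (_ \in E).
by rewrite -ltnS subn1 (ltn_predK lt).
Qed.

Lemma sum_subsets_exchange (r : nat) (f : nat -> rat) :
  \sum_(S : {set 'I_m} | #|S| == r) \sum_(i | S \subset edge_set i) f #|edge_set i|
  = \sum_i 'C(#|edge_set i|, r)%:R * f #|edge_set i|.
Proof.
rewrite (exchange_big_dep predT) //=.
apply: eq_bigr => i _; rewrite -cards_draws mulr_natl -sumr_const.
by apply: eq_bigl => S; rewrite inE andbC.
Qed.

End Incidence.

(** * The bound for a fixed graph *)

(** Here r = s - 1 and d = k - s + 1, so [r ^ 2 <= d + r + 1] is s^2 - 2s <= k. *)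
Lemma incidence_le {m n r t d : nat} {E : {set 'I_m * 'I_n}} {b : rat} :
  let N := ((t - 1) * (m - r))%N in
  let a := (N %% d)%N in
  (0 < r)%N -> (0 < d)%N -> (r ^ 2 <= d + r + 1)%N ->
  b = (r%:R * d%:R - a%:R * r%:R) / ((d%:R + r%:R + 1) * d%:R - a%:R * r%:R) ->
  Kst_free r.+1 t E ->
  #|E|%:R <= 'C(m, r)%:R / 'C(d + r, r)%:R *
    ((N %/ d)%:R * ((d%:R + (d%:R + r%:R + 1) * b) / r.+1%:R)
     + a%:R * ((1 - r%:R * b) / r.+1%:R))
    + (d%:R + r%:R + 1) * (r%:R - b) / r.+1%:R * n%:R.
Proof.
move=> N a r0 d0 rd bE free.
have ad : (a < d)%N by rewrite ltn_mod.
have adR : a%:R < d%:R :> rat by rewrite ltr_nat.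
have dR : 0 < d%:R :> rat by rewrite ltr0n.
have rR : 0 < r%:R :> rat by rewrite ltr0n.
have sR : 0 < r.+1%:R :> rat by rewrite ltr0n.
have aR : 0 <= a%:R :> rat by rewrite ler0n.
have CK : 0 < 'C(d + r, r)%:R :> rat by rewrite ltr0n bin_gt0 leq_addl.
have den : 0 < (d%:R + r%:R + 1) * d%:R - a%:R * r%:R :> rat by nra.
have bE' : b * ((d%:R + r%:R + 1) * d%:R - a%:R * r%:R) = r%:R * d%:R - a%:R * r%:R.
  by rewrite bE divfK // gt_eqF.
have b0 : 0 <= b by rewrite bE divr_ge0 ?(ltW den) //; nra.
have kb : (d%:R + r%:R + 1) * b <= r%:R.
  rewrite bE mulrA ler_pdivrMr //.
  by have := mulr_ge0 (mulr_ge0 aR (ltW rR)) (addr_ge0 ler01 (ltW dR)); lra.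
have rdR : r%:R * r%:R <= d%:R + r%:R + 1 :> rat.
  by rewrite -natrM -natrD natr1 ler_nat mulnn -[(_ + _).+1]addn1.
(* Makes [om] nonnegative; the bound on [r ^ 2] enters here. *)
have rb : r%:R * b <= 1.
  have r1 : 1 <= r%:R :> rat by rewrite ler1n.
  rewrite bE mulrA ler_pdivrMr //.
  have := ler_wpM2r (ltW dR) rdR; have := ler_wpM2l (mulr_ge0 aR (ltW rR)) r1.
  by lra.
set h := (d%:R + (d%:R + r%:R + 1) * b) / r.+1%:R.
set om := (1 - r%:R * b) / r.+1%:R.
set c := (d%:R + r%:R + 1) * (r%:R - b) / r.+1%:R.
have sE : r.+1%:R * h = d%:R + (d%:R + r%:R + 1) * b by rewrite mulrC divfK // gt_eqF.
have omE : r.+1%:R * om = 1 - r%:R * b by rewrite mulrC divfK // gt_eqF.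
have cE : c = (d + r)%:R - h.
  have s0 : r%:R + 1 != 0 :> rat by rewrite natr1 pnatr_eq0.
  by rewrite /c /h natrD -(natr1 r); field.
pose y := ((d + r)%:R - r%:R * h) / d%:R.
have yE : d%:R * y = (d + r)%:R - r%:R * h by rewrite mulrC divfK // gt_eqF.
have om0 : 0 <= om by rewrite divr_ge0 ?subr_ge0 // ltW.
have h0 : 0 <= h by rewrite divr_ge0 ?(ltW sR) //; nra.
have omh : om * d%:R <= h.
  rewrite -(ler_pM2l sR) mulrA omE sE.
  by have := mulr_ge0 b0 (ler0n rat (r * d + d + r + 1)); rewrite !natrD natrM; lra.
have hk : r.+1%:R * h <= (d + r)%:R by rewrite sE natrD lerD2l.
(* The balancing condition of [sum_concave_le]: multiplied by (r + 1) d, it is r + 1 times [bE']. *)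
have yeq : y * (d%:R - a%:R) = h - a%:R * om.
  have : r.+1%:R * d%:R * (y * (d%:R - a%:R)) = r.+1%:R * d%:R * (h - a%:R * om).
    have -> : r.+1%:R * d%:R * (y * (d%:R - a%:R))
       = (d%:R - a%:R) * (r.+1%:R * (d + r)%:R - r%:R * (r.+1%:R * h)).
      transitivity (r.+1%:R * (d%:R * y) * (d%:R - a%:R)); first by ring.
      by rewrite yE; ring.
    have -> : r.+1%:R * d%:R * (h - a%:R * om)
       = d%:R * (r.+1%:R * h) - d%:R * a%:R * (r.+1%:R * om) by ring.
    rewrite sE omE natrD -(natr1 r).
    by have := congr1 ( *%R (r%:R + 1)) bE'; lra.
  by apply: mulfI; rewrite mulf_neq0 // gt_eqF.
have y_h : h <= y * d%:R.
  by rewrite mulrC yE -(lerD2r (r%:R * h)) subrK; move: hk; rewrite -(natr1 r); lra.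
have y0 : 0 <= y by rewrite -(pmulr_lge0 _ dR); apply: le_trans y_h.
(* Hence [f] below is the minimum of its two lines, which gives [f_lines]. *)
have omy : om <= y.
  rewrite -(ler_pM2r dR); exact: le_trans y_h.
pose f (j : nat) : rat := h + (if (j <= d + r)%N then y else om) * (j%:R - (d + r)%:R).
(* Sizes j < r are included: the binomial coefficient vanishes there. *)
have f_le j : j%:R <= 'C(j, r)%:R / 'C(d + r, r)%:R * f j + c.
  rewrite -lerBlDr cE opprB addrCA addrA /f; case: leqP => jk.
    exact: lower_line.
  have [i ->] : exists i, j = (d + r + i)%N by exists (j - (d + r))%N; rewrite subnKC // ltnW.
  rewrite [(d + r + i)%:R]natrD.
  have -> : h + ((d + r)%:R + i%:R) - (d + r)%:R = h + i%:R by ring.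
  have -> : (d + r)%:R + i%:R - (d + r)%:R = i%:R :> rat by ring.
  exact: upper_line.
have f_lines j : (r <= j)%N ->
    f j <= h + om * ((j - r)%:R - d%:R) /\ f j <= h + y * ((j - r)%:R - d%:R).
  move=> rj; have -> : (j - r)%:R - d%:R = j%:R - (d + r)%:R :> rat.
    by rewrite natrB // natrD; ring.
  rewrite /f !lerD2l; case: leqP => jk; split=> //.
    by apply: ler_wnM2r => //; rewrite subr_le0 ler_nat.
  by apply: ler_wpM2r => //; rewrite subr_ge0 ler_nat ltnW.
have f_S (S : {set 'I_m}) : #|S| == r ->
    \sum_(i | S \subset edge_set E i) f #|edge_set E i|
    <= (N %/ d)%:R * h + a%:R * om.
  move/eqP => Sr.
  have rE i : S \subset edge_set E i -> (r <= #|edge_set E i|)%N.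
    by rewrite -Sr; apply: subset_leq_card.
  apply: (sum_concave_le (fun i => #|edge_set E i| - r)%N d y (divn_eq N d)) => //.
  - exact: Kst_free_excess.
  - by move=> i /rE /f_lines [].
  - by move=> i /rE /f_lines [].
rewrite card_incidence natr_sum.
apply: le_trans (ler_sum _ (fun i _ => f_le _)) _.
rewrite big_split /= sumr_const card_ord mulr_natr lerD2r.
have -> : \sum_i 'C(#|edge_set E i|, r)%:R / 'C(d + r, r)%:R * f #|edge_set E i|
   = (\sum_i 'C(#|edge_set E i|, r)%:R * f #|edge_set E i|) / 'C(d + r, r)%:R.
  by rewrite mulr_suml; apply: eq_bigr => i _; rewrite mulrAC.
rewrite -sum_subsets_exchange [leRHS]mulrAC ler_pM2r ?invr_gt0 //.
apply: le_trans (ler_sum _ f_S) _.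
rewrite -[in leRHS](card_ord m) -card_draws [leRHS]mulr_natl -sumr_const.
by under [leRHS]eq_bigl => S do rewrite inE.
Qed.

Theorem theorem1p3 (s t m n k : nat)
    (hs : (2 <= s <= m)%N) (ht : (2 <= t <= n)%N)
    (hk : (maxn 2 (s ^ 2 - 2 * s) <= k <= m)%N) :
  (zarankiewicz m n s t)%:R <= Bk k m n s t.
Proof.
case: s hs hk => // r /andP[r0 rm] /andP[]; rewrite geq_max => /andP[k2 rk] km.
rewrite ltnS in r0.
have [d kE] : exists d, (k = d + r)%N by exists (k - r)%N; nia.
(* k > r follows from k >= 2 when r = 1 and from k >= r^2 - 1 when r >= 2. *)
have d0 : (0 < d)%N by nia.
have rd : (r ^ 2 <= d + r + 1)%N by nia.
have dR : d%:R != 0 :> rat by rewrite pnatr_eq0 -lt0n.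
have t1 : (1 <= t)%N by case/andP: ht => /ltnW.
have aE : alpha m r.+1 t k = (((t - 1) * (m - r)) %% d)%N.
  by rewrite /alpha kE; congr ((_ * _) %% _)%N; lia.
pose N := ((t - 1) * (m - r))%N.
have kR : k%:R - r.+1%:R + 1 = d%:R :> rat by rewrite kE natrD -(natr1 r); ring.
have sR : r.+1%:R - 1 = r%:R :> rat by rewrite -(natr1 r) addrK.
have kR1 : k%:R + 1 = d%:R + r%:R + 1 :> rat by rewrite kE natrD.
have kR2 : k%:R - r.+1%:R + 2 = d%:R + 1 :> rat by rewrite -kR; ring.
have NR : (t%:R - 1) * (m%:R - r.+1%:R + 1)
    = (N %/ d)%:R * d%:R + (N %% d)%:R :> rat.
  rewrite -natrM -natrD -divn_eq natrM !natrB // 1?ltnW // -(natr1 r); ring.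
have [E free ->] : {E : {set 'I_m * 'I_n} | Kst_free r.+1 t E
    & zarankiewicz m n r.+1 t = #|E|}.
  apply: eq_bigmax_cond; apply/card_gt0P; exists set0.
  apply/forallP => S; apply/forallP => T; apply/implyP => /andP[/eqP Ss /eqP Tt].
  by rewrite subset0 -cards_eq0 cardsX Ss Tt; case: (t) t1.
have bE : beta m r.+1 t k = (r%:R * d%:R - (N %% d)%:R * r%:R)
    / ((d%:R + r%:R + 1) * d%:R - (N %% d)%:R * r%:R).
  by rewrite /beta aE kR sR kR1.
apply: le_trans (incidence_le r0 d0 rd bE free) _.
rewrite le_eqVlt; apply/orP; left; apply/eqP.
rewrite /Bk aE NR kR sR kR1 kR2 -kE -/N [(r.+1 - 1)%N]subn1.
(* Once N = q d + alpha is substituted, the two bounds agree identically in [b]. *)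
move: (beta _ _ _ _) => b.
have s0 : r%:R + 1 != 0 :> rat by rewrite natr1 pnatr_eq0.
congr (_ * _ + _).
by rewrite -(natr1 r); field; rewrite dR.
Qed.
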